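(* Let $n\ge 1$, and let $C=(\chi^\lambda_\mu)_{\lambda,\mu\in\mathcal S_n}$ be the supercharacter table of $\mathrm{UT}_n(q)$ (rows indexed by $\lambda$, columns by $\mu$), whose entries are viewed as expressions in $q$. Let the rows and columns of all matrices be indexed by $\mathcal S_n$, listed in a linear order in which $\lambda$ comes before $\nu$ whenever $\lambda<\nu$. Then $C$ has a factorization $$C=AB,$$ where $A$ is a lower-triangular matrix with entries in $\mathbb Z[q]$ and $B$ is an upper-triangular matrix with entries in $\mathbb Z[q^{-1}]$.
   Context: For $n\ge 0$, $\mathcal S_n$ denotes the set of set partitions of $\{1,\dots,n\}$, encoded as sets of arcs: a set partition is a subset $\lambda\subseteq\{i\frown j\mid 1\le i<j\le n\}$ (arcs are just pairs $(i,j)$ with $i<j$) such that for all $i<j<k$, $i\frown k\in\lambda$ implies $i\frown j\notin\lambda$ and $j\frown k\notin\lambda$. $|\lambda|$ is the number of arcs. For $\lambda,\mu\in\mathcal S_n$ put $\dim(\lambda)=\sum_{i\frown j\in\lambda}(j-i)$ and $\mathrm{nst}^\lambda_\mu=\#\{i<j<k<l\mid i\frown l\in\lambda,\ j\frown k\in\mu\}$. $\mathrm{UT}_n(q)$ is the group of $n\times n$ unipotent upper triangular matrices over the finite field $\mathbb F_q$. The supercharacter theory used has superclasses the equivalence classes of: $u\sim v$ iff $u=xt(v-1)t^{-1}y+1$ for some $x,y\in\mathrm{UT}_n(q)$ and some invertible diagonal matrix $t$; both superclasses and supercharacters are indexed by $\mathcal S_n$. The value $\chi^\lambda_\mu$ of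 the supercharacter $\chi^\lambda$ on the superclass indexed by $\mu$ is $$\chi^\lambda_\mu=\frac{(q-1)^{|\lambda|-|\lambda\cap\mu|}\,q^{\dim(\lambda)-|\lambda|}\,(-1)^{|\lambda\cap\mu|}}{q^{\mathrm{nst}^\lambda_\mu}}$$ if for all $i<j<k$ with $i\frown k\in\lambda$ one has $i\frown j\notin\mu$ and $j\frown k\notin\mu$; and $\chi^\lambda_\mu=0$ otherwise. Here $q$ is regarded as an indeterminate, so $\chi^\lambda_\mu\in\mathbb Z[q,q^{-1}]$ and the factorization is an identity of matrices over $\mathbb Z[q,q^{-1}]$, which may be specialized at any prime power $q$. Order on $\mathcal S_n$: let $\mathrm{dimv}(\lambda)$ be the integer partition (parts in weakly decreasing order) given by the multiset $\{l-i\mid i\frown l\in\lambda\}$ and $\mathrm{rnode}(\lambda)$ the integer partition given by the set $\{l\mid i\frown l\in\lambda\}$. Compare integer partitions lexicographically from the largest part to the smallest (a proper initial segment being smaller). Then $\lambda<\nu$ means: $\mathrm{dimv}(\lambda)<_{\mathrm{lex}}\mathrm{dimv}(\nu)$, or $\mathrm{dimv}(\lambda)=\mathrm{dimv}(\nu)$ and $\mathrm{rnode}(\lambda)<_{\mathrm{lex}}\mathrm{rnode}(\nu)$. *)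

(* Defs.v *)
From HB Require Import structures.
From mathcomp Require Import all_boot all_order all_algebra fraction.

Set Implicit Arguments.
Unset Strict Implicit.
Unset Printing Implicit Defensive.

Import Order.TTheory GRing.Theory Num.Theory.
Local Open Scope ring_scope.

(* The node set {1, ..., n} is represented by 'I_n, the node l + 1 being
   represented by l : 'I_n; only rnode below depends on this shift. *)
Definition is_setpart (n : nat) (lam : {set 'I_n * 'I_n}) : bool :=
  [forall a in lam, (a.1 < a.2)%N] &&
  [forall i : 'I_n, forall j : 'I_n, forall k : 'I_n,
     (i < j < k)%N && ((i, k) \in lam) ==>
       ((i, j) \notin lam) && ((j, k) \notin lam)].

Record setpart (n : nat) := SetPart {
  arcs :> {set 'I_n * 'I_n};
  _ : is_setpart arcs }.

HB.instance Definition _ (n : nat) := [isSub for @arcs n].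
HB.instance Definition _ (n : nat) := [Finite of setpart n by <:].

Definition dim (n : nat) (lam : setpart n) : nat :=
  (\sum_(a in arcs lam) (a.2 - a.1))%N.

Definition nst (n : nat) (lam mu : setpart n) : nat :=
  #|[set t : ('I_n * 'I_n) * ('I_n * 'I_n) |
       let: ((i, l), (j, k)) := t in
       [&& (i < j)%N, (j < k)%N, (k < l)%N,
           (i, l) \in arcs lam & (j, k) \in arcs mu]]|.

Definition compatible (n : nat) (lam mu : setpart n) : bool :=
  [forall i : 'I_n, forall j : 'I_n, forall k : 'I_n,
     (i < j < k)%N && ((i, k) \in arcs lam) ==>
       ((i, j) \notin arcs mu) && ((j, k) \notin arcs mu)].

(* The indeterminate q.  The ring Z[q, q^-1] is taken inside its field of
   fractions, the field of fractions of Z[q]. *)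
Definition q : {fraction {poly int}} := @FracField.tofrac {poly int} 'X.

(* Both subtractions of exponents are genuine: lam :&: mu is contained in lam,
   and every arc contributes at least 1 to dim lam. *)
Definition superchar (n : nat) (lam mu : setpart n) : {fraction {poly int}} :=
  if compatible lam mu then
    (q - 1) ^+ (#|arcs lam| - #|arcs lam :&: arcs mu|)
      * q ^+ (dim lam - #|arcs lam|)
      * (-1) ^+ #|arcs lam :&: arcs mu|
      / q ^+ nst lam mu
  else 0.

Definition dimv (n : nat) (lam : setpart n) : seq nat :=
  sort geq [seq (a.2 - a.1)%N | a : 'I_n * 'I_n <- enum (arcs lam)].

Definition rnode (n : nat) (lam : setpart n) : seq nat :=
  sort geq [seq (nat_of_ord l).+1 | l <- enum [set a.2 | a in arcs lam]].

(* The order on seqlexi nat is the lexicographic one, in which a proper initial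
   segment is smaller. *)
Definition lex_lt (s t : seq nat) : bool :=
  ((s : seqlexi nat) < (t : seqlexi nat))%O.

Definition setpart_lt (n : nat) (lam nu : setpart n) : bool :=
  lex_lt (dimv lam) (dimv nu) ||
  (dimv lam == dimv nu) && lex_lt (rnode lam) (rnode nu).

(* A listing of all set partitions, without repetition, in which lam comes
   before nu whenever lam < nu; setpart_lt is not total in general. *)
Definition linear_listing (n : nat)
    (e : 'I_#|{: setpart n}| -> setpart n) : Prop :=
  bijective e /\ (forall i j, setpart_lt (e i) (e j) -> (i < j)%N).

Definition superchar_table (n : nat) (e : 'I_#|{: setpart n}| -> setpart n) :
    'M[{fraction {poly int}}]_#|{: setpart n}| :=
  \matrix_(i, j) superchar (e i) (e j).

(* y belongs to the subring Z[x]. *)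
Definition in_Zadj (K : fieldType) (x y : K) : Prop :=
  exists p : {poly int}, y = (map_poly intr p).[x].

(* Main.v *)
(* Write w_N(a) = q^-(number of arcs of N strictly nesting a).  Up to a factor
   depending only on lam, the value chi^lam_mu is a product over the arcs a of
   mu of weights f_lam(a).  Splitting off one shortest arc of mu at a time, which
   nests no other arc of mu, turns this product into
     sum_(nu \subset mu) prod_(a in nu) (f_lam(a) - w_nu(a))
                         * prod_(a in mu :\: nu) w_nu(a),
   and the two products are the entries of A and B, up to a rescaling by powers
   of q.  Triangularity of A: if f_lam(a) != w_nu(a) for an arc a of nu outside
   lam, then a longer arc belongs to exactly one of lam and nu; hence the longest
   arcs in the symmetric difference all belong to lam, and dimv nu < dimv lam. *)
Require Import Defs.
From HB Require Import structures.
From mathcomp Require Import all_boot all_order all_algebra fraction.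
From mathcomp Require Import zify ring.

Set Implicit Arguments.
Unset Strict Implicit.
Unset Printing Implicit Defensive.

Import Order.TTheory GRing.Theory Num.Theory.
Local Open Scope ring_scope.

(** * Expansion of a product over subsets *)

(** Induction on [#|M|], removing an element [t] of minimal [len]. By [hw], adding [t] to [N]
    changes no weight on [M], so the terms for [N] and [t |: N] share all factors except that of
    [t], and these add up to [(f t - w N t) + w N t = f t]. *)
Lemma sum_subset_prod (R : comNzRingType) (T : finType) (len : T -> nat)
    (f : T -> R) (w : {set T} -> T -> R)
    (hw : forall N t a, (len t <= len a)%N -> w (t |: N) a = w N a)
    (M : {set T}) :
  \sum_(N : {set T} | N \subset M)
     (\prod_(a in N) (f a - w N a)) * (\prod_(a in M :\: N) w N a)
  = \prod_(a in M) f a.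
Proof.
elim: {M}#|M| {-2}M (erefl #|M|) => [|m IHm] M cardM.
  rewrite (cards0_eq cardM) big_set0 (big_pred1 set0) => [|N].
    by rewrite setD0 !big_set0 mulr1.
  by rewrite subset0.
have [t0 t0M] : exists t0, t0 \in M by apply/card_gt0P; rewrite cardM.
pose t := [arg min_(t < t0 in M) len t].
have [tM tmin] : t \in M /\ forall a, a \in M -> (len t <= len a)%N.
  by rewrite /t; case: arg_minnP => // i iM imin.
have cardMt : #|M :\ t| = m.
  by apply: succn_inj; rewrite -cardM (cardsD1 t M) tM.
rewrite (big_setD1 t tM) /= -(IHm _ cardMt) (bigID (fun N : {set T} => t \in N)) /=.
rewrite (reindex_onto (fun N => t |: N) (fun N => N :\ t)) /=; last first.
  by move=> N /andP[_ tN]; rewrite setD1K.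
rewrite (eq_bigl (fun N : {set T} => N \subset M :\ t)); last first.
  move=> N; rewrite setU11 andbT subUset sub1set tM /= subsetD1.
  congr (_ && _); apply/eqP/idP => [<-|tN]; first by rewrite !inE eqxx.
  by rewrite setU1K.
rewrite [X in _ + X](eq_bigl (fun N : {set T} => N \subset M :\ t)); last first.
  by move=> N; rewrite subsetD1.
rewrite -big_split mulr_sumr; apply: eq_bigr => N /=.
rewrite subsetD1 => /andP[NM tN].
have wE a : a \in M -> w (t |: N) a = w N a by move=> aM; rewrite hw ?tmin.
rewrite big_setU1 //= wE // (big_setD1 t (A := M :\: N)) ?inE ?tN //=.
have -> : \prod_(a in N) (f a - w (t |: N) a) = \prod_(a in N) (f a - w N a).
  by apply: eq_bigr => a /(subsetP NM) /wE->.
have -> : M :\: (t |: N) = (M :\ t) :\: N.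
  by apply/setP => a; rewrite !inE negb_or -andbA andbCA.
have -> : (M :\: N) :\ t = (M :\ t) :\: N.
  by apply/setP => a; rewrite !inE andbCA.
have -> : \prod_(a in (M :\ t) :\: N) w (t |: N) a
        = \prod_(a in (M :\ t) :\: N) w N a.
  by apply: eq_bigr => a; rewrite !inE => /and3P[_ _ /wE].
by ring.
Qed.

(** * Comparing set partitions through their longest differing arcs *)

Lemma lex_lt_sorted (s t : seq nat) (d : nat) :
    sorted geq s -> sorted geq t ->
    (forall x, (d < x)%N -> count_mem x s = count_mem x t) ->
    (count_mem d s < count_mem d t)%N ->
  lex_lt s t.
Proof.
rewrite /lex_lt; elim: t s => [|y t IHt] [|x s] //= sx ty eqc ltc.
rewrite Order.SeqLexiOrder.ltxi_cons.
have geq_trans : transitive geq by move=> a b c ab bc; exact: leq_trans bc ab.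
case: (ltngtP x y) => [ltxy|ltyx|eqxy].
- by rewrite leEnat (ltnW ltxy) leqNgt ltxy.
(* A larger head [x] of [s] would exceed [d], so it would occur in [t], whose parts are all at most
   [y]. *)
- have dy : (d <= y)%N.
    have : d \in y :: t by rewrite -has_pred1 has_count; apply: leq_trans ltc.
    rewrite inE => /predU1P[->//|dt].
    by move: ty; rewrite (path_sortedE geq_trans) => /andP[/allP/(_ _ dt)].
  have := eqc x (leq_ltn_trans dy ltyx); rewrite eqxx (ltn_eqF ltyx).
  suff -> : count_mem x t = 0%N by [].
  apply/count_memPn/negP => xt.
  move: ty; rewrite (path_sortedE geq_trans) => /andP[/allP/(_ _ xt) /=].
  by rewrite leqNgt ltyx.
- rewrite -eqxy in ty eqc ltc *; rewrite lexx /=; apply: IHt.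
  + exact: path_sorted sx.
  + exact: path_sorted ty.
  + by move=> z /eqc /addnI.
  + by move: ltc; rewrite ltn_add2l.
Qed.

Definition arclen (n : nat) (a : 'I_n * 'I_n) : nat := (a.2 - a.1)%N.

Lemma count_dimv (n : nat) (lam : setpart n) (d : nat) :
  count_mem d (Defs.dimv lam) = #|[set a in arcs lam | arclen a == d]|.
Proof.
rewrite /Defs.dimv (permP (permEl (perm_sort _ _))) count_map.
by rewrite -sum1_count -sum1dep_card big_enum_cond.
Qed.

(** Take a longest arc [a] of the symmetric difference. By the hypothesis every arc of [nu] of that
    length lies in [lam], so [a] is in [lam] only: the length counts agree above [arclen a] and are
    strictly larger for [lam] at it. *)
Lemma setpart_lt_symdiff (n : nat) (nu lam : setpart n) :
    nu != lam ->
    (forall a, a \in arcs nu -> a \notin arcs lam ->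
       exists2 b, (arclen a < arclen b)%N
         & (b \in arcs nu) != (b \in arcs lam)) ->
  setpart_lt nu lam.
Proof.
move=> neq dom; apply/orP; left.
have [a0 a0P] : exists a, (a \in arcs nu) != (a \in arcs lam).
  apply/existsP; rewrite -negb_forall; apply: contraNN neq => /forallP eqnl.
  by apply/eqP/val_inj/setP => a; apply/eqP.
have [a aP amax] := @arg_maxnP _ a0
  (fun a => (a \in arcs nu) != (a \in arcs lam)) (@arclen n) a0P.
have agree b : (arclen a < arclen b)%N -> (b \in arcs nu) = (b \in arcs lam).
  by move=> ltab; apply: contraTeq ltab => /amax; rewrite -leqNgt.
have sub b : b \in arcs nu -> arclen b = arclen a -> b \in arcs lam.
  move=> bnu eqba; apply: contraT => /(dom b bnu)[c].
  by rewrite eqba => /agree->; rewrite eqxx.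
apply: (@lex_lt_sorted _ _ (arclen a)).
- by apply: sort_sorted => x y; apply: leq_total.
- by apply: sort_sorted => x y; apply: leq_total.
- move=> x ltx; rewrite !count_dimv; apply: eq_card => b; rewrite !inE.
  by case: eqP => [eqbx|]; rewrite ?andbF // !andbT agree // eqbx.
rewrite !count_dimv; apply: proper_card; apply/properP; split.
  by apply/subsetP => b; rewrite !inE => /andP[bnu /eqP e]; rewrite sub ?e ?eqxx.
have /andP[alam anu] : (a \in arcs lam) && (a \notin arcs nu).
  move: aP; case anu: (a \in arcs nu); last by case: (a \in arcs lam).
  by rewrite (sub a anu erefl).
by exists a; rewrite !inE ?alam ?eqxx // (negPf anu).
Qed.

(** * Nestings and conflicts between arcs *)

Definition over (n : nat) (N : {set 'I_n * 'I_n}) (a : 'I_n * 'I_n) : nat :=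
  #|[set b in N | (b.1 < a.1)%N && (a.2 < b.2)%N]|.

(** A nesting pair is strictly longer than the nested one. Lengths are shifted by [n] because the
    pairs need not be arcs: truncated differences would also be 0 for reversed pairs, which can nest
    each other. *)
Lemma over_setU1 (n : nat) (N : {set 'I_n * 'I_n}) (t a : 'I_n * 'I_n) :
  (t.2 + n - t.1 <= a.2 + n - a.1)%N -> over (t |: N) a = over N a.
Proof.
move=> le_ta; apply: eq_card => b; rewrite !inE.
case: eqP => [->|//] /=.
suff -> : (t.1 < a.1)%N && (a.2 < t.2)%N = false by rewrite andbF.
by have := ltn_ord a.1; lia.
Qed.

Lemma arclen_nested (n : nat) (a b : 'I_n * 'I_n) :
  (a.1 < a.2)%N -> (b.1 < a.1)%N -> (a.2 < b.2)%N -> (arclen a < arclen b)%N.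
Proof. by rewrite /arclen; lia. Qed.

Lemma over_symdiff (n : nat) (N M : {set 'I_n * 'I_n}) (a : 'I_n * 'I_n) :
    over N a != over M a -> (a.1 < a.2)%N ->
  exists2 b, (arclen a < arclen b)%N & (b \in N) != (b \in M).
Proof.
move=> neq lta.
have /existsP[b /andP[ltb bNM]] :
    [exists b, (arclen a < arclen b)%N && ((b \in N) != (b \in M))].
  apply: contraNT neq => /existsPn same; apply/eqP/eq_card => b.
  rewrite !inE; have := same b; rewrite negb_and negbK.
  case/orP => [|/eqP->//]; move=> nltb.
  suff -> : (b.1 < a.1)%N && (a.2 < b.2)%N = false by rewrite !andbF.
  by apply: contraNF nltb => /andP[]; apply: arclen_nested.
by exists b.
Qed.

(** The obstruction to [compatible] caused by a single arc [a] of [mu]. *)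
Definition conflict (n : nat) (lam : setpart n) (a : 'I_n * 'I_n) : bool :=
  [exists b in arcs lam, (b.1 == a.1) && (a.2 < b.2)%N
                      || (b.2 == a.2) && (b.1 < a.1)%N].

Lemma setpart_arc_lt (n : nat) (lam : setpart n) (a : 'I_n * 'I_n) :
  a \in arcs lam -> (a.1 < a.2)%N.
Proof. by have /andP[/forall_inP lt_lam _] := valP lam; apply: lt_lam. Qed.

Lemma compatible_refl (n : nat) (lam : setpart n) : compatible lam lam.
Proof. by have /andP[] := valP lam. Qed.

Lemma compatibleE (n : nat) (lam mu : setpart n) :
  compatible lam mu = [forall a in arcs mu, ~~ conflict lam a].
Proof.
apply/forallP/forall_inP => [comp [i j] amu | nconf i].
  apply/exists_inPn => -[i' k] blam /=; have /= ltij := setpart_arc_lt amu.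
  rewrite negb_or !negb_and -!implybE; apply/andP; split.
    apply/implyP => /eqP eqi; apply/negP => ltjk; subst i'.
    have /forallP/(_ j)/forallP/(_ k) := comp i.
    by rewrite ltij ltjk blam amu.
  apply/implyP => /eqP eqk; apply/negP => ltii; subst k.
  have /forallP/(_ i)/forallP/(_ j) := comp i'.
  by rewrite ltij ltii blam amu andbF.
apply/forallP => j; apply/forallP => k; apply/implyP => /andP[/andP[ltij ltjk] ik].
apply/andP; split; apply/negP => /nconf/exists_inPn/(_ _ ik) /=.
  by rewrite eqxx ltjk.
by rewrite eqxx ltij orbT.
Qed.

(** The witness is the arc of [lam] in conflict with [a]: it is longer, and [nu], a set partition
    containing [a], cannot contain it. *)
Lemma conflict_symdiff (n : nat) (nu lam : setpart n) (a : 'I_n * 'I_n) :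
    a \in arcs nu -> conflict lam a ->
  exists2 b, (arclen a < arclen b)%N & (b \in arcs nu) != (b \in arcs lam).
Proof.
move=> anu /exists_inP[b blam ab]; exists b.
  move: (setpart_arc_lt anu) (setpart_arc_lt blam) ab; rewrite /arclen.
  by case: a b {anu blam} => [i j] [k l] /= ? ? /orP[]/andP[/eqP->]; lia.
have := compatible_refl nu; rewrite compatibleE => /forall_inP/(_ _ anu).
move=> /exists_inPn nconf; rewrite blam eqb_id; apply/negP => /nconf.
by rewrite ab.
Qed.

Lemma nstE (n : nat) (lam mu : setpart n) :
  nst lam mu = (\sum_(a in arcs mu) over (arcs lam) a)%N.
Proof.
under eq_bigr do rewrite /over -sum1dep_card.
rewrite (exchange_big_dep predT) //= pair_big_dep /nst -sum1dep_card /=.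
apply: eq_bigl => -[[i l] [j k]] /=.
case jk: ((j, k) \in _); last by rewrite !andbF.
have /= -> := setpart_arc_lt jk.
by case: (i < j)%N; case: (k < l)%N; rewrite ?andbT ?andbF.
Qed.

(** * Product formula for the supercharacter values *)

(** The weight f_lam(a). A common arc of [lam] and [mu] turns one factor [q - 1] of the value into
    -1, whence [- (q - 1)^-1]. *)
Definition weight (n : nat) (lam : setpart n) (a : 'I_n * 'I_n) :
    {fraction {poly int}} :=
  if conflict lam a then 0
  else (if a \in arcs lam then - (q - 1)^-1 else 1) * q ^- over (arcs lam) a.

Lemma q_neq0 : q != 0.
Proof. by rewrite /q tofrac_eq0 polyX_eq0. Qed.

Lemma q_sub1_neq0 : q - 1 != 0.
Proof.
rewrite /q -tofrac1 -tofracB tofrac_eq0.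
exact: monic_neq0 (monicXsubC 1).
Qed.

(** The prefactor is the value at the empty set partition. An incompatible [mu] has a conflicting
    arc, whose weight 0 kills the product. *)
Lemma superchar_prod (n : nat) (lam mu : setpart n) :
  superchar lam mu = (q - 1) ^+ #|arcs lam| * q ^+ (Defs.dim lam - #|arcs lam|)
                     * \prod_(a in arcs mu) weight lam a.
Proof.
rewrite /superchar compatibleE.
case: (boolP [forall a in _, _]) => [/forall_inP nconf | ]; last first.
  rewrite negb_forall_in => /exists_inP[a amu]; rewrite negbK => conf.
  by rewrite (bigD1 a) //= /weight conf mul0r mulr0.
have -> : \prod_(a in arcs mu) weight lam a
  = \prod_(a in arcs mu) ((if a \in arcs lam then - (q - 1)^-1 else 1)
                          * q ^- over (arcs lam) a).
  by apply: eq_bigr => a /nconf /negPf conf; rewrite /weight conf.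
rewrite big_split /= prodfV prodrXr -nstE -big_mkcondr /=.
rewrite (eq_bigl (mem (arcs lam :&: arcs mu))); last first.
  by move=> a; rewrite !inE andbC.
rewrite prodr_const [(- (q - 1)^-1) ^+ _]exprNn exprVn.
rewrite expfB_cond; last first.
  by rewrite (negPf q_sub1_neq0) subset_leq_card ?subsetIl.
by ring.
Qed.

(** * Closure properties of Z[x] *)

Section ZadjClosed.
Variables (K : fieldType) (x : K).

Lemma in_Zadj_gen : in_Zadj x x.
Proof. by exists 'X; rewrite map_polyX hornerX. Qed.

Lemma in_Zadj0 : in_Zadj x 0.
Proof. by exists 0; rewrite rmorph0 horner0. Qed.

Lemma in_Zadj1 : in_Zadj x 1.
Proof. by exists 1; rewrite rmorph1 hornerC. Qed.

Lemma in_ZadjB y z : in_Zadj x y -> in_Zadj x z -> in_Zadj x (y - z).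
Proof. by move=> [p ->] [r ->]; exists (p - r); rewrite rmorphB hornerD hornerN. Qed.

Lemma in_ZadjM y z : in_Zadj x y -> in_Zadj x z -> in_Zadj x (y * z).
Proof. by move=> [p ->] [r ->]; exists (p * r); rewrite rmorphM hornerM. Qed.

Lemma in_ZadjX y m : in_Zadj x y -> in_Zadj x (y ^+ m).
Proof.
move=> yZ; elim: m => [|m IHm]; first exact: in_Zadj1.
by rewrite exprS; apply: in_ZadjM.
Qed.

Lemma in_Zadj_prod (I : finType) (P : pred I) (F : I -> K) :
  (forall i, P i -> in_Zadj x (F i)) -> in_Zadj x (\prod_(i | P i) F i).
Proof. by move=> FZ; apply: big_ind => //; [exact: in_Zadj1 | exact: in_ZadjM]. Qed.

End ZadjClosed.

(* Without the factors q ^+ #|{: 'I_n * 'I_n}|, which upper_entry compensates, the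
   entries would not all be polynomials in q: for n = 9, lam = {(1,9)} and
   nu = {(1,8), (2,9), (3,4), (4,5), (5,6), (6,7)}, one gets
   (q - 1)^5 / q. *)
Definition lower_entry (n : nat) (lam nu : setpart n) : {fraction {poly int}} :=
  (q - 1) ^+ #|arcs lam| * q ^+ (Defs.dim lam - #|arcs lam|)
  * \prod_(a in arcs nu)
      (q ^+ #|{: 'I_n * 'I_n}| * (weight lam a - q ^- over (arcs nu) a)).

Definition upper_entry (n : nat) (nu mu : setpart n) : {fraction {poly int}} :=
  if arcs nu \subset arcs mu then
    q ^- (#|{: 'I_n * 'I_n}| * #|arcs nu|)
    * \prod_(a in arcs mu :\: arcs nu) q ^- over (arcs nu) a
  else 0.

(** * Integrality and triangularity of the two factors *)

Lemma lower_entry_in_Zadj (n : nat) (lam nu : setpart n) :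
  in_Zadj q (lower_entry lam nu).
Proof.
have qZ m : in_Zadj q (q ^+ m) by apply/in_ZadjX/in_Zadj_gen.
have q1Z : in_Zadj q (q - 1).
  by apply: in_ZadjB; [exact: in_Zadj_gen | exact: in_Zadj1].
have shift (N : {set 'I_n * 'I_n}) a : q ^+ #|{: 'I_n * 'I_n}| * q ^- over N a
               = q ^+ (#|{: 'I_n * 'I_n}| - over N a).
  by rewrite expfB_cond // (negPf q_neq0) max_card.
(* Each arc of [nu] in [lam] contributes at most one denominator [q - 1]. So [L] factors of
   [(q - 1) ^+ #|arcs lam|] are set aside and distributed over these arcs. *)
pose L := #|arcs nu :&: arcs lam|.
have leL : (L <= #|arcs lam|)%N by rewrite subset_leq_card ?subsetIr.
rewrite /lower_entry -(subnK leL) exprD -!mulrA.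
apply: in_ZadjM; first exact: in_ZadjX.
rewrite mulrCA; apply: in_ZadjM => //.
rewrite -prodr_const.
rewrite (eq_bigl (fun a => (a \in arcs nu) && (a \in arcs lam))); last first.
  by move=> a; rewrite inE.
rewrite big_mkcondr -big_split; apply: in_Zadj_prod => a _ /=.
rewrite mulrBr shift /weight; case: (conflict lam a).
  rewrite mulr0; apply: in_ZadjM; last by apply: in_ZadjB => //; apply: in_Zadj0.
  by case: ifP => // _; apply: in_Zadj1.
case: ifP => _; last by rewrite !mul1r shift; apply: in_ZadjB.
rewrite mulrBr [q ^+ _ * _]mulrCA shift mulrA mulrN mulfV ?q_sub1_neq0 // mulN1r.
apply: in_ZadjB; last exact: in_ZadjM.
by rewrite -sub0r; apply: in_ZadjB => //; apply: in_Zadj0.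
Qed.

Lemma upper_entry_in_Zadj (n : nat) (nu mu : setpart n) :
  in_Zadj q^-1 (upper_entry nu mu).
Proof.
have qZ m : in_Zadj q^-1 (q ^- m).
  by rewrite -exprVn; apply/in_ZadjX/in_Zadj_gen.
rewrite /upper_entry; case: ifP => _; last exact: in_Zadj0.
by apply: in_ZadjM => //; apply: in_Zadj_prod.
Qed.

(** For an arc of [nu] outside [lam], a nonzero factor means either a conflict with [lam] or
    different nesting counts in [lam] and [nu]; both yield a longer arc of the symmetric
    difference. *)
Lemma lower_entry_neq0 (n : nat) (lam nu : setpart n) :
  lower_entry lam nu != 0 -> nu != lam -> setpart_lt nu lam.
Proof.
rewrite /lower_entry mulf_eq0 negb_or => /andP[_ /prodf_neq0 facN0] neq.
apply: (setpart_lt_symdiff neq) => a anu alam.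
have := facN0 a anu; rewrite mulf_eq0 negb_or => /andP[_].
rewrite /weight; case: ifP => [conf _ | _].
  exact: conflict_symdiff conf.
rewrite (negPf alam) mul1r => neqw.
apply: over_symdiff; last exact: setpart_arc_lt anu.
by apply: contraNneq neqw => ->; rewrite subrr.
Qed.

Lemma upper_entry_neq0 (n : nat) (nu mu : setpart n) :
  upper_entry nu mu != 0 -> nu != mu -> setpart_lt nu mu.
Proof.
rewrite /upper_entry; case: ifP => [/subsetP sub _ neq|]; last by rewrite eqxx.
(* No arc of [nu] lies outside [mu], so the condition on such arcs is vacuous. *)
by apply: (setpart_lt_symdiff neq) => a /sub->.
Qed.

(** * The factorization *)

(** This lets the sum over arc subsets of [mu] be read as a sum over set partitions. *)
Lemma is_setpart_sub (n : nat) (N M : {set 'I_n * 'I_n}) :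
  N \subset M -> is_setpart M -> is_setpart N.
Proof.
move=> /subsetP sub /andP[/forall_inP ltM ncM]; apply/andP; split.
  by apply/forall_inP => a /sub /ltM.
apply/forallP => i; apply/forallP => j; apply/forallP => k; apply/implyP.
move=> /andP[ijk /sub ik].
have /forallP/(_ i)/forallP/(_ j)/forallP/(_ k) := ncM.
by rewrite ijk ik => /andP[ij jk]; rewrite !(contra (sub _)).
Qed.

Lemma superchar_factor (n : nat) (lam mu : setpart n) :
  superchar lam mu = \sum_nu lower_entry lam nu * upper_entry nu mu.
Proof.
rewrite superchar_prod.
rewrite -(@sum_subset_prod _ _ (fun a : 'I_n * 'I_n => (a.2 + n - a.1)%N)
  (weight lam) (fun N a => q ^- over N a)); last first.
  by move=> N t a le_ta; rewrite over_setU1.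
rewrite [RHS](bigID (fun nu : setpart n => arcs nu \subset arcs mu)) /=.
rewrite [X in _ = _ + X]big1; last first.
  by move=> nu /negPf nsub; rewrite /upper_entry nsub mulr0.
rewrite addr0 mulr_sumr.
rewrite (reindex_omap (@arcs n) (insub : _ -> option (setpart n))) /=; last first.
  move=> N sub; have Np := is_setpart_sub sub (valP mu).
  by rewrite insubT.
apply: eq_big => [nu | nu /andP[sub _]].
  by rewrite (valK nu) eqxx andbT.
rewrite /lower_entry /upper_entry sub big_split /= prodr_const -exprM -!mulrA.
congr (_ * _); congr (_ * _).
(* The rescaling powers of [q] in the two entries are inverse to each other. *)
by rewrite [RHS]mulrCA mulVKf // expf_neq0 ?q_neq0.
Qed.

Theorem corollary4p1 (n : nat) (hn : (1 <= n)%N)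
    (e : 'I_#|{: setpart n}| -> setpart n) (he : linear_listing e) :
  exists A B : 'M[{fraction {poly int}}]_#|{: setpart n}|,
    [/\ superchar_table e = A *m B,
        is_trig_mx A,
        (forall i j, in_Zadj q (A i j)),
        is_trig_mx B^T
      & (forall i j, in_Zadj q^-1 (B i j))].
Proof.
have [bij_e lt_e] := he.
exists (\matrix_(i, j) lower_entry (e i) (e j)),
  (\matrix_(i, j) upper_entry (e i) (e j)).
split.
- apply/matrixP => i j; rewrite !mxE superchar_factor.
  rewrite (reindex e) /=; last exact: onW_bij.
  by apply: eq_bigr => k _; rewrite !mxE.
(* By contraposition: a nonzero entry at [(i, j)] forces [e j = e i] or [setpart_lt (e j) (e i)],
   hence [j <= i]. *)
- apply/is_trig_mxP => i j ltij; rewrite mxE; apply: contraTeq ltij.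
  move=> /lower_entry_neq0 ltA; rewrite -leqNgt.
  case: (eqVneq (e j) (e i)) => [/(bij_inj bij_e)->// | /ltA /lt_e].
  exact: ltnW.
- by move=> i j; rewrite mxE; apply: lower_entry_in_Zadj.
- apply/is_trig_mxP => i j ltij; rewrite !mxE; apply: contraTeq ltij.
  move=> /upper_entry_neq0 ltB; rewrite -leqNgt.
  case: (eqVneq (e j) (e i)) => [/(bij_inj bij_e)->// | /ltB /lt_e].
  exact: ltnW.
- by move=> i j; rewrite mxE; apply: upper_entry_in_Zadj.
Qed.
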